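(* There is a constant $c>0$ such that for all sufficiently large $m$ the following holds: if $F$ is a clause-set representing $\mathrm{PHP}^m_m$ (with respect to the variable set $V_m=\{p_{i,j}: i,j\in\{1,\dots,m\}\}$) and $\mathrm{hd}^{V_m}(F)\le 1$, then $\ell(F)\ge m^{c\log m}$ (i.e. $\ell(F)=m^{\Omega(\log m)}$).
   Context: Literals are variables $v$ or negations $\overline{v}$; clauses are finite sets of literals without complementary pair; clause-sets finite sets of clauses; $\bot$ empty clause, $\top$ empty clause-set; $\ell(F)=\sum_{C\in F}|C|$. A partial assignment $\varphi$ maps a finite variable set $\mathrm{var}(\varphi)$ to $\{0,1\}$; $\varphi*F$ removes satisfied clauses and false literals; $F$ is unsatisfiable if no $\varphi$ gives $\varphi*F=\top$. $\mathrm{PHP}^m_m$ has variables $p_{i,j}$ ($i,j\in\{1,\dots,m\}$) and clauses $\{p_{i,1},\dots,p_{i,m}\}$ for each $i$, and $\{\overline{p_{i_1,j}},\overline{p_{i_2,j}}\}$ for all $j$ and $i_1\ne i_2$. A clause-set $F$ with $V_m\subseteq\mathrm{var}(F)$ represents $\mathrm{PHP}^m_m$ if the restrictions to $V_m$ of the total satisfying assignments of $F$ are exactly the satisfying assignments of $\mathrm{PHP}^m_m$. Hardness: resolution of $C,D$ with exactly one clash $x\in C,\overline{x}\in D$ gives $(C\cup D)\setminus\{x,\overline{x}\}$; a resolution tree is a finite rooted tree, inner nodes with two children, labelled by clauses, inner labels resolvents of children's labels; a refutation of $F$ has leaf labels in $F$ and root $\bot$. Horton–Strahler number: $0$ for one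 node; for subtrees $T_1,T_2$ it is $\mathrm{hts}(T_1)+1$ if $\mathrm{hts}(T_1)=\mathrm{hts}(T_2)$, else the maximum. For unsatisfiable $F$, $\mathrm{hd}(F)$ is the minimal Horton–Strahler number of a refutation of $F$. Relativised hardness for a variable set $V$: $\mathrm{hd}^V(\top)=0$ and for $F\ne\top$, $\mathrm{hd}^V(F)$ is the maximum of $\mathrm{hd}(\varphi*F)$ over partial assignments $\varphi$ with $\mathrm{var}(\varphi)\subseteq V$ and $\varphi*F$ unsatisfiable. *)

(* Defs.v *)
From mathcomp Require Import all_boot finmap.
From mathcomp Require Import boolp classical_sets reals exp.

Set Implicit Arguments.
Unset Strict Implicit.
Unset Printing Implicit Defensive.

Local Open Scope fset_scope.
Local Open Scope fmap_scope.

(* (v, true) is the literal v, (v, false) is its negation. *)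
Notation literal T := (T * bool)%type.

Section ClauseSets.
Variable T : choiceType.

Definition pos (v : T) : literal T := (v, true).
Definition neg (v : T) : literal T := (v, false).
Definition compl (x : literal T) : literal T := (x.1, ~~ x.2).
Definition compls (C : {fset literal T}) : {fset literal T} :=
  [fset compl x | x in C].

Definition is_clause (C : {fset literal T}) : bool :=
  [disjoint C & compls C]%fset.
Definition is_clause_set (F : {fset {fset literal T}}) : Prop :=
  forall C, C \in F -> is_clause C.

Definition vars (F : {fset {fset literal T}}) : {fset T} :=
  [fset x.1 | C in F, x in (C : {fset literal T})].

Definition ell (F : {fset {fset literal T}}) : nat := \sum_(C <- F) #|` C|.

(* A partial assignment is a finite map phi : {fmap T -> bool}, with var(phi)
   its domain; lit_val phi x is None when phi leaves the variable of x
   unassigned. *)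
Definition lit_val (phi : {fmap T -> bool}) (x : literal T) : option bool :=
  omap (eq_op x.2) phi.[? x.1].

Definition satisfies_clause (phi : {fmap T -> bool}) (C : {fset literal T}) :
  bool := has (fun x => lit_val phi x == Some true) C.

Definition apply_pa (phi : {fmap T -> bool}) (F : {fset {fset literal T}}) :
    {fset {fset literal T}} :=
  [fset [fset x in (C : {fset literal T}) | lit_val phi x != Some false]
    | C in F & ~~ satisfies_clause phi C].

Definition unsat (F : {fset {fset literal T}}) : Prop :=
  forall phi, apply_pa phi F <> fset0.

Definition total_sat (F : {fset {fset literal T}}) (phi : {fmap T -> bool}) :
  Prop := domf phi = vars F /\ apply_pa phi F = fset0.

Inductive rtree : Type :=
| RLeaf of {fset literal T}
| RNode of {fset literal T} & rtree & rtree.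

Definition label (t : rtree) : {fset literal T} :=
  match t with RLeaf C => C | RNode C _ _ => C end.

(* x ranges over literals, so the order of C and D is immaterial. *)
Definition is_resolvent (C D E : {fset literal T}) : Prop :=
  exists x : literal T,
    C `&` compls D = [fset x] /\ E = (C `|` D) `\` [fset x; compl x].

Fixpoint is_resolution_tree (F : {fset {fset literal T}}) (t : rtree) : Prop :=
  match t with
  | RLeaf C => is_clause C /\ C \in F
  | RNode C t1 t2 =>
      [/\ is_clause C, is_resolvent (label t1) (label t2) C,
          is_resolution_tree F t1 & is_resolution_tree F t2]
  end.

Definition is_refutation (F : {fset {fset literal T}}) (t : rtree) : Prop :=
  is_resolution_tree F t /\ label t = fset0.

Fixpoint hts (t : rtree) : nat :=
  match t with
  | RLeaf _ => 0
  | RNode _ t1 t2 =>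
      if hts t1 == hts t2 then (hts t1).+1 else maxn (hts t1) (hts t2)
  end.

(* [xget 0 A] is an element of A if A is nonempty and 0 otherwise. The
   default is used only for satisfiable F, which have no refutation. *)
Definition hd (F : {fset {fset literal T}}) : nat :=
  let A := [set k | exists2 t, is_refutation F t & hts t = k]%classic in
  xget 0 [set k | A k /\ forall j, A j -> k <= j]%classic.

(* There are finitely many phi with domain inside V, so the maximum exists as
   soon as some such phi makes phi * F unsatisfiable; otherwise the value is
   the default 0. *)
Definition hdV (V : {fset T}) (F : {fset {fset literal T}}) : nat :=
  if F == fset0 then 0 else
  let A := [set k | exists phi : {fmap T -> bool},
      [/\ (domf phi `<=` V)%fset, unsat (apply_pa phi F)
        & hd (apply_pa phi F) = k]]%classic in
  xget 0 [set k | A k /\ forall j, A j -> j <= k]%classic.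

Definition represents (F G : {fset {fset literal T}}) (V : {fset T}) : Prop :=
  V `<=` vars F /\
  forall psi : {fmap T -> bool},
    (exists2 phi, total_sat F phi & phi.[& V] = psi) <-> total_sat G psi.

Section Pigeonhole.
Variables (m : nat) (p : 'I_m * 'I_m -> T).

Definition php_vars : {fset T} := [fset p ij | ij : 'I_m * 'I_m].

Definition PHP : {fset {fset literal T}} :=
  [fset [fset pos (p (i, j)) | j : 'I_m] | i : 'I_m] `|`
  [fset [fset neg (p (x.1.1, x.2)); neg (p (x.1.2, x.2))]
    | x : 'I_m * 'I_m * 'I_m & x.1.1 != x.1.2].

End Pigeonhole.

End ClauseSets.

(* Main.v *)
(* Setting p_e to 0 for all edges e outside a bipartite graph G makes F
   unsatisfiable iff G has no perfect matching. A refutation of Horton-Strahler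
   number at most 1 has a leaf child at every inner node, so unit propagation
   finds the contradiction. Running unit propagation for as many rounds as there
   are literals therefore yields a monotone circuit, of size polynomial in
   ell(F), for the perfect matching function, and Razborov's lower bound for it
   applies.

   That bound is proved by the method of approximations. Positive tests are the
   m! permutations; negative tests are the graphs of monochromatic edges of a
   2-colouring h of the 2m vertices, which have no perfect matching when the
   first colour class is odd. Gates are approximated by families of matchings
   with at most l edges, closed under adding a matching that is almost implied
   on random colourings: disjunctions then lose few colourings, and since a
   closed family has few minimal members (a sunflower argument on vertex sets),
   conjunctions, approximated by intersections, lose few permutations. The
   choice l ~ log m balances both errors. *)
Require Import Defs.
From mathcomp Require Import boolp classical_sets reals exp.
From mathcomp Require Import all_boot all_order all_fingroup all_algebra finmap.
From mathcomp Require Import zify ring lra.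

Set Implicit Arguments.
Unset Strict Implicit.
Unset Printing Implicit Defensive.

(** * Two-coloured bipartite graphs *)

(** A set [h] is recovered from [g h] and [h :&: D], because [g] changes nothing outside [D]. *)
Lemma card_refit (V : finType) (D : {set V}) (g : {set V} -> {set V})
    (S1 S2 : {set {set V}}) :
  (forall h, h \in S1 -> g h \in S2) -> (forall h, g h :\: D = h :\: D) ->
  #|S1| <= #|S2| * 2 ^ #|D|.
Proof.
move=> gS gD; rewrite -card_powerset -cardsX.
rewrite -(card_imset (f := fun h => (g h, h :&: D))); last first.
  by move=> h1 h2 /eqP; rewrite xpair_eqE => /andP[/eqP e1 /eqP e2];
    rewrite -(setID h1 D) -(setID h2 D) e2 -(gD h1) -(gD h2) e1.
apply/subset_leq_card/subsetP => _ /imsetP[h hS ->].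
by rewrite !inE gS //= subsetIr.
Qed.

Section Graphs.
Variable m : nat.
Local Notation edge := ('I_m * 'I_m)%type.
Local Notation vertex := ('I_m + 'I_m)%type.

Definition src (e : edge) : vertex := inl e.1.
Definition tgt (e : edge) : vertex := inr e.2.
Definition ends (A : {set edge}) : {set vertex} := (src @: A) :|: (tgt @: A).
Definition matching (A : {set edge}) : bool :=
  [forall e in A, forall f in A, (e.1 == f.1) || (e.2 == f.2) ==> (e == f)].
(** A set of vertices stands for the 2-colouring whose classes are it and its complement. *)
Definition mono (h : {set vertex}) : {set edge} :=
  [set e | (src e \in h) == (tgt e \in h)].
Definition inside (A : {set edge}) (K : {set vertex}) : {set edge} :=
  [set e in A | (src e \in K) && (tgt e \in K)].

Lemma matchingP (A : {set edge}) e f : matching A -> e \in A -> f \in A ->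
  (e.1 == f.1) || (e.2 == f.2) -> e = f.
Proof.
by move=> /forallP/(_ e)/implyP + eA => /(_ eA)/forallP/(_ f)/implyP + fA
  => /(_ fA)/implyP/[apply]/eqP.
Qed.

Lemma matching_sub (A B : {set edge}) : A \subset B -> matching B -> matching A.
Proof.
move=> /subsetP AB mB; apply/forallP => e; apply/implyP => eA.
apply/forallP => f; apply/implyP => fA; apply/implyP => ef.
by apply/eqP; apply: matchingP mB _ _ ef; exact: AB.
Qed.

Lemma src_ends (A : {set edge}) e : e \in A -> src e \in ends A.
Proof. by move=> eA; rewrite inE imset_f. Qed.

Lemma tgt_ends (A : {set edge}) e : e \in A -> tgt e \in ends A.
Proof. by move=> eA; rewrite inE imset_f ?orbT. Qed.

Lemma card_ends (A : {set edge}) : #|ends A| <= 2 * #|A|.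
Proof.
rewrite mul2n -addnn (leq_trans (leq_card_setU _ _)) //.
by rewrite leq_add // leq_imset_card.
Qed.

Lemma endsP (A : {set edge}) v :
  reflect (exists2 e, e \in A & v = src e \/ v = tgt e) (v \in ends A).
Proof.
apply: (iffP idP) => [|[e eA [] ->]]; last 2 first.
- exact: src_ends.
- exact: tgt_ends.
by rewrite inE => /orP[] /imsetP[e eA ->]; exists e => //; [left | right].
Qed.

Lemma inside_sub (A : {set edge}) K : inside A K \subset A.
Proof. by apply/subsetP => e; rewrite inE => /andP[]. Qed.

Lemma inside0 (A : {set edge}) : inside A set0 = set0.
Proof. by apply/setP => e; rewrite [in LHS]inE !in_set0 !andbF. Qed.

Lemma mono_agree (A : {set edge}) (h1 h2 : {set vertex}) :
  (forall v, v \in ends A -> (v \in h1) = (v \in h2)) ->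
  (A \subset mono h1) = (A \subset mono h2).
Proof.
move=> hh; apply/subsetP/subsetP => sub e eA; have := sub e eA;
  by rewrite !inE hh ?src_ends // hh ?tgt_ends.
Qed.

(* Inside [K] nothing changes; every edge of [A] leaving [K] has a private
   outer end, which copies the colour of the inner one. *)
Definition refit (A : {set edge}) (K h : {set vertex}) : {set vertex} :=
  (h :\: (ends A :\: K)) :|: [set v in ends A :\: K |
    [exists e in A, ((src e == v) && (tgt e \in K :&: h)) ||
                    ((tgt e == v) && (src e \in K :&: h))]].

Lemma refit_out A K h : refit A K h :\: (ends A :\: K) = h :\: (ends A :\: K).
Proof.
apply/setP => v; rewrite !inE.
by case: (v \in K) => /=; case: (v \in src @: A); case: (v \in tgt @: A);
   rewrite //= ?orbF.
Qed.

Lemma in_refit_out A (K h : {set vertex}) v :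
  v \notin ends A :\: K -> (v \in refit A K h) = (v \in h).
Proof.
by move=> vD; move/setP/(_ v): (refit_out A K h); rewrite in_setD [in RHS]in_setD vD.
Qed.

Lemma in_refit (A : {set edge}) (K h : {set vertex}) v : v \in ends A -> v \notin K ->
  (v \in refit A K h) =
    [exists e in A, ((src e == v) && (tgt e \in K :&: h)) ||
                    ((tgt e == v) && (src e \in K :&: h))].
Proof.
move=> vA vK; have vD : v \in ends A :\: K by rewrite in_setD vK.
by rewrite in_setU in_setD vD /= [in LHS]inE vD.
Qed.

Lemma refit_mono A K h : matching A -> inside A K \subset mono h ->
  A \subset mono (refit A K h).
Proof.
move=> mA /subsetP Zh; apply/subsetP => e eA; rewrite inE.
(* An edge with one end in [K] has its outer end coloured after the inner one, and no other edge of
   the matching interferes. An edge with no end in [K] gets both ends outside the new set. *)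
have [sK|sK] := boolP (src e \in K); have [tK|tK] := boolP (tgt e \in K).
- rewrite !in_refit_out ?in_setD ?sK ?tK //.
  by have := Zh e; rewrite !inE eA sK tK => /(_ isT).
- rewrite in_refit_out ?in_setD ?sK // in_refit ?tgt_ends //.
  apply/eqP; apply/idP/existsP => [sh|[f]]; first by exists e;
    rewrite eA !inE eqxx sK sh orbT.
  case/andP => fA /orP[/andP[/eqP]|/andP[/eqP[ef]]] //.
  by have <- : f = e by [apply: matchingP mA fA eA _; rewrite ef eqxx orbT];
    rewrite inE => /andP[].
- rewrite [X in _ == X]in_refit_out ?in_setD ?tK // in_refit ?src_ends //.
  apply/eqP/esym; apply/idP/existsP => [sh|[f]]; first by exists e;
    rewrite eA !inE eqxx tK sh.
  case/andP => fA /orP[/andP[/eqP[ef]]|/andP[/eqP]] //.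
  by have <- : f = e by [apply: matchingP mA fA eA _; rewrite ef eqxx];
    rewrite inE => /andP[].
- rewrite !in_refit ?src_ends ?tgt_ends //.
  apply/eqP; transitivity false; last apply/esym;
    apply/existsP => -[f /andP[fA]] /orP[] /andP[/eqP] // [ef].
    have -> : f = e by apply: matchingP mA fA eA _; rewrite ef eqxx.
    by rewrite inE (negbTE tK).
  have -> : f = e by apply: matchingP mA fA eA _; rewrite ef eqxx orbT.
  by rewrite inE (negbTE sK).
Qed.

End Graphs.

(** * Closed families of small matchings *)

Section Approximators.
Variables m l r : nat.
Local Notation edge := ('I_m * 'I_m)%type.
Local Notation vertex := ('I_m + 'I_m)%type.
Local Notation family := {set {set edge}}.

Definition small (A : {set edge}) : bool := matching A && (#|A| <= l).

Definition accepts (W : family) (G : {set edge}) : bool :=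
  [exists A in W, A \subset G].

Lemma acceptsP (W : family) (G : {set edge}) :
  reflect (exists2 A, A \in W & A \subset G) (accepts W G).
Proof. exact: exists_inP. Qed.

(* The members of a sunflower with vertex core [K] and edge core [Z]; all edges
   of [A] outside [Z] have an end outside [K]. *)
Definition petals (Z : {set edge}) (K : {set vertex}) (A : {set edge}) : bool :=
  [&& small A, K \subset ends A & inside A K == Z].

(** With q = [2 ^ (2 * l)], this number of petals makes the failure bound (1 - 1/q)^(q r) at most
    2^(-r). *)
Definition petal_count := 2 ^ (2 * l) * r.

(** While [Z] is monochromatic, recolouring the at most [2 * l] outer ends of a petal makes it
    monochromatic too and disturbs no other petal. So each petal cuts the count by a factor 1 -
    1/q. *)
Lemma petals_rare (Z : {set edge}) (K : {set vertex}) (s : seq {set edge}) :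
  all (petals Z K) s ->
  pairwise (fun A B : {set edge} => [disjoint ends A :\: K & ends B :\: K]) s ->
  #|[set h | (Z \subset mono h) && all (fun A : {set edge} => ~~ (A \subset mono h)) s]|
     * (2 ^ (2 * l)) ^ size s
  <= (2 ^ (2 * l)).-1 ^ size s * 2 ^ (2 * m).
Proof.
set q := 2 ^ _; elim: s => [_ _|A s IHs] /=.
  rewrite !expn0 muln1 mul1n (leq_trans (max_card _)) //.
  rewrite -cardsT -powersetT card_powerset cardsT card_sum card_ord.
  by rewrite addnn mul2n.
case/andP=> /and3P[/andP[mA cA] KA /eqP iA] sP /andP[disA pws].
have {IHs} := IHs sP pws.
set H := [set h | _]; set H' := [set h | _ && (_ && _)].
have H'E : H' = H :\: [set h | A \subset mono h].
  by apply/setP => h; rewrite !inE andbCA andbA.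
have AD : #|ends A :\: K| <= 2 * l.
  rewrite (leq_trans (subset_leq_card (subsetDl _ _))) //.
  by rewrite (leq_trans (card_ends _)) // leq_mul2l cA orbT.
have : #|H| <= #|H :&: [set h | A \subset mono h]| * q.
  apply: (@leq_trans (#|H :&: [set h | A \subset mono h]| * 2 ^ #|ends A :\: K|)).
    2: by rewrite leq_mul2l leq_exp2l ?AD ?orbT.
  apply: (card_refit (g := refit A K)) (@refit_out _ A K) => h.
  rewrite !inE => /andP[Zh /allP sh].
  have ZK : ends Z \subset K.
    apply/subsetP => v /endsP[e]; rewrite -iA inE => /and3P[_ sK tK].
    by case=> ->.
  rewrite refit_mono // ?iA // andbT.
  rewrite (mono_agree (h2 := h)) ?Zh => [/=|v vZ]; last first.
    by rewrite in_refit_out // in_setD (subsetP ZK).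
  apply/allP => B Bs; rewrite (mono_agree (h2 := h)) ?sh // => v vB.
  rewrite in_refit_out //; apply/negP => vA.
  have /disjointFr/(_ vA) := allP disA B Bs.
  by rewrite in_setD vB andbT; move: vA; rewrite in_setD => /andP[-> _].
rewrite H'E cardsD; set a := #|H|; set b := #|_ :&: _|.
have q0 : 0 < q by rewrite expn_gt0.
have ba : b <= a by apply/subset_leq_card/subsetIl.
move=> abq IH; rewrite !expnS.
have : (a - b) * q <= q.-1 * a by rewrite -subn1 !mulnBl mulnC; lia.
move: IH; set x := q ^ _; set y := q.-1 ^ _; set z := 2 ^ _ => IH le1.
rewrite mulnA (leq_trans (leq_mul le1 (leqnn x))) //.
by rewrite -!mulnA leq_mul2l IH orbT.
Qed.

(** This is (1 - 1/q)^q <= 1/2, from the first two terms of the binomial expansion of ((q - 1) +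
    1)^q. *)
Lemma expn_pred_le (q : nat) : 0 < q -> 2 * q.-1 ^ q <= q ^ q.
Proof.
case: q => [|q] // _; rewrite /= [in leqLHS]expnS.
have bern : forall n, q ^ n.+1 + n.+1 * q ^ n <= q.+1 ^ n.+1.
  elim=> [|n IHn]; first by rewrite !expn1 expn0; lia.
  rewrite [in leqRHS]expnS (leq_trans _ (leq_mul (leqnn q.+1) IHn)) //.
  rewrite !expnS; set x := q ^ n; nia.
have := bern q; rewrite -expnS; apply: leq_trans.
by rewrite mul2n -addnn leq_add2l expnS leq_mul2r leqnSn orbT.
Qed.

(* Approximators are families of small matchings containing every small [Z]
   that they almost imply on the test graphs [mono h]; the tolerated error is
   a fraction [2 ^- r] of all [2 ^ (2 * m)] colourings. *)
Definition closed (W : family) : Prop :=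
  (forall A, A \in W -> small A) /\
  forall Z, small Z ->
    #|[set h | (Z \subset mono h) && ~~ accepts W (mono h)]| * 2 ^ r
      <= 2 ^ (2 * m) -> Z \in W.

Lemma closed_petals (W : family) (Z : {set edge}) (K : {set vertex})
    (s : seq {set edge}) :
  closed W -> small Z -> {subset s <= W} -> all (petals Z K) s ->
  pairwise (fun A B : {set edge} => [disjoint ends A :\: K & ends B :\: K]) s ->
  size s = petal_count -> Z \in W.
Proof.
move=> [_ clW] sZ sW sP pws sz; apply: clW => //.
have := petals_rare sP pws; rewrite sz /petal_count; set q := 2 ^ (2 * l).
set S1 := [set _ | _]; set S2 := [set _ | _].
have S21 : #|S2| <= #|S1|.
  apply/subset_leq_card/subsetP => h; rewrite !inE => /andP[-> nW] /=.
  apply/allP => A /sW AW; apply: contra nW => Ah.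
  by apply/acceptsP; exists A.
move=> le1.
have : 2 ^ r * q.-1 ^ (q * r) <= q ^ (q * r).
  by rewrite !(expnM _ q) -expnMn; case: (r) => // r';
    rewrite leq_exp2r // expn_pred_le // expn_gt0.
move: le1; set x := q.-1 ^ _; set y := q ^ _ => le1 le2.
have y0 : 0 < y by rewrite !expn_gt0.
(* If [x] is zero, then [S1] is empty, hence so is [S2]; otherwise [x] can be cancelled. *)
have [x0|x0] := posnP x.
  by move: le1; rewrite x0 mul0n leqn0 muln_eq0 (gtn_eqF y0) orbF => /eqP; lia.
rewrite -(leq_pmul2r x0) (leq_trans _ (leq_trans le1 _)) //.
  by rewrite -mulnA leq_mul.
by rewrite mulnC.
Qed.
End Approximators.

(** A list built greedily either reaches length [k] or stops because the union of its sets meets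
    every [D A]. An index with empty [D A] may occur repeatedly. *)
Lemma greedy_disjoint (I V : finType) (P : pred I) (D : I -> {set V})
    (d k : nat) :
  (forall A, P A -> #|D A| <= d) ->
  (exists s : seq I, [/\ all P s,
     pairwise (fun A B => [disjoint D A & D B]) s & size s = k]) \/
  (exists2 U : {set V}, #|U| <= d * k & forall A, P A -> D A :&: U != set0).
Proof.
move=> dP; elim: k => [|k [[s [sP pws <-]]|[U Uk UP]]]; first by left; exists [::].
  pose U := \bigcup_(A <- s) D A.
  have [/existsP[A /andP[PA /eqP AU]]|none] :=
    boolP [exists A, P A && (D A :&: U == set0)].
    left; exists (A :: s); split => //=; first by rewrite PA.
    rewrite pws andbT; apply/allP => B Bs; rewrite -setI_eq0 -subset0 -AU.
    by rewrite setIS //; rewrite /U bigcup_seq; apply: bigcup_sup Bs.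
  right; exists U.
    rewrite /U mulnS; apply: leq_trans (leq_addl _ _); rewrite mulnC.
    elim: s sP {pws U none} => [|A s IHs] /=; first by rewrite big_nil cards0.
    case/andP=> PA /IHs; rewrite big_cons mulSn => le.
    by rewrite (leq_trans (leq_card_setU _ _)) // leq_add ?dP.
  move=> A PA; apply: contra none => AU; apply/existsP; exists A.
  by rewrite PA.
by right; exists U => //; rewrite (leq_trans Uk) // leq_mul2l leqnSn orbT.
Qed.

Lemma leq_card_bigcup (I V : finType) (P : {set I}) (F : I -> {set V}) (d : nat) :
  (forall i, i \in P -> #|F i| <= d) -> #|\bigcup_(i in P) F i| <= #|P| * d.
Proof.
move=> Fd; rewrite -sum_nat_const.
apply: (big_ind2 (fun (A : {set V}) n => #|A| <= n)) => //; first by rewrite cards0.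
by move=> A1 n1 A2 n2 A1n A2n; rewrite (leq_trans (leq_card_setU _ _)) ?leq_add.
Qed.

(** * Few minimal members in a closed family *)

Section Minimal.
Variables m l r : nat.
Local Notation edge := ('I_m * 'I_m)%type.
Local Notation vertex := ('I_m + 'I_m)%type.
Local Notation family := {set {set edge}}.

Lemma matching_ends (A : {set edge}) e f w : matching A -> e \in A -> f \in A ->
  w = src e \/ w = tgt e -> w = src f \/ w = tgt f -> e = f.
Proof.
move=> mA eA fA [] -> [] //; rewrite /src /tgt => -[ef];
  by apply: matchingP mA eA fA _; rewrite ef eqxx ?orbT.
Qed.

Definition joining (w o : vertex) : {set edge} :=
  [set e | ((src e == w) && (tgt e == o)) || ((tgt e == w) && (src e == o))].

Lemma joining_id w : joining w w = set0.
Proof.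
apply/setP => e; rewrite !inE; apply/negP.
by move=> /orP[] /andP[/eqP <-].
Qed.

(** A matching covers [w] by a single edge. Adding [w] to [K] brings in this edge if its other end
    [o] lies in [K]; otherwise nothing is added, which is encoded by [o = w]. *)
Lemma inside_setU1 (A : {set edge}) (K : {set vertex}) w :
  matching A -> w \in ends A -> w \notin K ->
  exists2 o, o \in w |: K & inside A (w |: K) = inside A K :|: joining w o.
Proof.
move=> mA /endsP[e eA we] wK.
have at_w f : f \in A -> w = src f \/ w = tgt f -> f = e.
  by move=> fA wf; apply: matching_ends mA fA eA wf we.
have [oK|oK] := boolP [exists o in K, e \in joining w o].
  case/existsP: oK => o /andP[oK ewo]; exists o; first by rewrite in_setU1 oK orbT.
  apply/setP => f; rewrite !inE.
  apply/idP/idP.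
    case/andP=> fA; case/andP.
    case/orP=> [/eqP sw|sK]; last case/orP=> [/eqP tw|tK].
    - by move: ewo; rewrite -(at_w f) ?inE ?fA => [->|//|]; rewrite ?orbT; auto.
    - by move: ewo; rewrite -(at_w f) ?inE ?fA => [->|//|]; rewrite ?orbT; auto.
    - by rewrite fA sK tK.
  case/orP=> [/and3P[-> -> ->]|fwo]; first by rewrite !orbT.
  have -> : f = e.
    move: ewo fwo; rewrite inE.
    case: e f {eA we at_w} => e1 e2 [f1 f2]; rewrite /src /tgt /=.
    by move=> /orP[]/andP[/eqP<- /eqP<-] /orP[]/andP[/eqP// [->] /eqP// [->]].
  rewrite eA /=; move: ewo; rewrite inE.
  by case/orP=> /andP[/eqP-> /eqP->]; rewrite eqxx oK orbT.
exists w; first by rewrite setU11.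
rewrite joining_id setU0; apply/setP => f; rewrite !inE.
apply/idP/idP; last by case/and3P=> -> -> ->; rewrite !orbT.
case/and3P=> fA sf tf; rewrite fA /=.
have noK o : o \in K -> e \in joining w o -> false.
  by move=> oK' ewo; case/negP: oK; apply/existsP; exists o; rewrite oK'.
case/orP: sf => [/eqP sw|sK]; case/orP: tf => [/eqP tw|tK]; rewrite ?sK ?tK //.
- by move: tw; rewrite -sw.
- have fe : f = e by apply: at_w; auto.
  suff: false by []. by apply: (noK _ tK); rewrite -fe inE sw !eqxx.
- have fe : f = e by apply: at_w; auto.
  suff: false by []. by apply: (noK _ sK); rewrite -fe inE tw !eqxx orbT.
Qed.

Definition minimal (W : {set {set edge}}) : {set {set edge}} :=
  [set A in W | [forall B in W, (B \subset A) ==> (B == A)]].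

Lemma minimal_below (W : family) A : A \in W ->
  exists2 B, B \in minimal W & B \subset A.
Proof.
move=> AW; have [B /minsetP[BW Bmin] BA] := @minset_exists _ (fun B => B \in W) A AW.
exists B => //; rewrite inE BW; apply/forall_inP => C CW; apply/implyP => CB.
by apply/eqP/Bmin.
Qed.

(** Counts the choices of a vertex [w] in the hitting set and of an [o] among [w] and at most
    [2 * l] core vertices. The successor keeps its powers positive. *)
Definition branching := (2 * l * petal_count l r * (2 * l).+1).+1.

(* A closed family contains the core of each of its large sunflowers, and a
   proper subset of a minimal member does not belong to the family. *)
Lemma few_minimal_petals (W : family) (Z : {set edge}) (K : {set vertex}) :
  closed l r W ->
  #|[set A in minimal W | petals l Z K A]| <= 1 \/
  exists2 U : {set vertex}, #|U| <= 2 * l * petal_count l r &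
    forall A, A \in minimal W -> petals l Z K A -> (ends A :\: K) :&: U != set0.
Proof.
move=> clW; set MZ := [set _ in _ | _].
have [->|[A0 A0M]] := set_0Vmem MZ; first by left; rewrite cards0.
have Zsmall : small l Z.
  move: A0M; rewrite inE => /and4P[_ /andP[mA cA] _ /eqP <-].
  rewrite /small (matching_sub (inside_sub A0 K)) //.
  by rewrite (leq_trans (subset_leq_card (inside_sub _ _))).
have dMZ A : A \in MZ -> #|ends A :\: K| <= 2 * l.
  rewrite inE => /and3P[_ /andP[_ cA] _].
  rewrite (leq_trans (subset_leq_card (subsetDl _ _))) //.
  by rewrite (leq_trans (card_ends _)) // leq_mul2l cA orbT.
have [[s [/allP sM pws sz]]|[U Uc UM]] := greedy_disjoint (petal_count l r) dMZ.
  left; have ZW : Z \in W.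
    apply: closed_petals clW Zsmall _ _ pws sz; last first.
      by apply/allP => A /sM; rewrite inE => /andP[].
    by move=> A /sM; rewrite !inE => /andP[/andP[]].
  rewrite -(cards1 Z); apply/subset_leq_card/subsetP => A.
  rewrite !inE => /and4P[/andP[_ /forall_inP/(_ Z ZW) + _ _ /eqP iA]].
  by rewrite -{1}iA inside_sub eq_sym.
by right; exists U => // A AM AP; apply: UM; rewrite inE AM.
Qed.

(* Branch on a new vertex [w] of the hitting set, and on the end [o] in [K] of
   the edge covering [w] ([o = w] when there is none). *)
Lemma minimal_petals (W : family) n (Z : {set edge}) (K : {set vertex}) :
  closed l r W -> 2 * l <= #|K| + n ->
  #|[set A in minimal W | petals l Z K A]| <= branching ^ n.
Proof.
move=> clW; elim: n Z K => [|n IHn] Z K Kn.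
  (* For [n = 0] the core has at least [2 * l] vertices, so it is all of [ends A] and leaves no
     vertex to be hit by [U]. *)
  have [//|[U _ UM]] := few_minimal_petals Z K clW.
  rewrite expn0 leqNgt; apply/negP => /ltnW/card_gt0P[A].
  rewrite inE => /andP[AM AP]; have /negP := UM A AM AP; apply.
  case/and3P: AP => /andP[_ cA] KA _.
  suff -> : K = ends A by rewrite setDv set0I.
  apply/eqP; rewrite eqEcard KA (leq_trans (card_ends A)) //.
  by rewrite addn0 in Kn; rewrite (leq_trans _ Kn) // leq_mul2l cA orbT.
have [le1|[U Uc UM]] := few_minimal_petals Z K clW.
  by rewrite (leq_trans le1) // expn_gt0.
set MZ := [set _ in _ | _].
have [->|[A0 A0M]] := set_0Vmem MZ; first by rewrite cards0.
have cK : #|K| <= 2 * l.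
  move: A0M; rewrite inE => /and4P[_ /andP[_ cA] /subset_leq_card KA _].
  by rewrite (leq_trans KA) // (leq_trans (card_ends _)) // leq_mul2l cA orbT.
pose next w o := [set A in minimal W | petals l (Z :|: joining w o) (w |: K) A].
have sub : MZ \subset
    \bigcup_(w in U :\: K) \bigcup_(o in w |: K) next w o.
  apply/subsetP => A; rewrite inE => /andP[AM AP].
  have /set0Pn[w] := UM A AM AP; rewrite in_setI in_setD -andbA => /and3P[wK wA wU].
  case/and3P: (AP) => /andP[mA cA] KA /eqP iA.
  have [o oK io] := inside_setU1 mA wA wK.
  apply/bigcupP; exists w; first by rewrite in_setD wK.
  apply/bigcupP; exists o => //.
  rewrite inE AM /petals /small mA cA io iA eqxx andbT /=.
  by rewrite subUset KA sub1set wA.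
rewrite (leq_trans (subset_leq_card sub)) //.
apply: (@leq_trans (#|U :\: K| * ((2 * l).+1 * branching ^ n))).
  apply: leq_card_bigcup => w; rewrite in_setD => /andP[wK wU].
  apply: (@leq_trans (#|w |: K| * branching ^ n)).
    apply: leq_card_bigcup => o oK; apply: IHn.
    by rewrite cardsU1 wK addSnnS.
  by rewrite leq_mul2r cardsU1 wK ltnS cK orbT.
rewrite mulnA expnS leq_mul2r (leq_trans _ (leqnSn _)) ?orbT //.
rewrite leq_mul2r (leq_trans (subset_leq_card (subsetDl _ _))) ?orbT //.
Qed.

Lemma card_minimal (W : family) : closed l r W ->
  #|minimal W| <= branching ^ (2 * l).
Proof.
move=> clW; rewrite -[leqLHS](_ : #|[set A in minimal W | petals l set0 set0 A]| = _).
  by apply: minimal_petals; rewrite // cards0.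
congr #|pred_of_set _|; apply/setP => A; rewrite inE.
have [|//] := boolP (A \in _); rewrite inE => /andP[AW _] /=.
by rewrite /petals (proj1 clW) // sub0set inside0 eqxx.
Qed.
End Minimal.

(** * Closure and intersection of families *)

Section Operations.
Variables m l r : nat.
Local Notation edge := ('I_m * 'I_m)%type.
Local Notation vertex := ('I_m + 'I_m)%type.
Local Notation family := {set {set edge}}.

Definition graph (s : {perm 'I_m}) : {set edge} := [set e | s e.1 == e.2].

Lemma graph_matching s : matching (graph s).
Proof.
apply/forallP => -[a b]; apply/implyP; rewrite inE /= => /eqP sa.
apply/forallP => -[c d]; apply/implyP; rewrite inE /= => /eqP sc.
apply/implyP; rewrite -sa -sc /= (inj_eq perm_inj) orbb => /eqP ->.
exact: eqxx.
Qed.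

(** Dividing by one such permutation [s0] leaves permutations that fix the sources of [U], and these
    are at least [l] points. *)
Lemma card_graph_superset (U : {set edge}) : l <= #|U| ->
  #|[set s | U \subset graph s]| <= (m - l)`!.
Proof.
move=> lU; have [->|[s0]] := set_0Vmem [set s | U \subset graph s].
  by rewrite cards0.
rewrite inE => Us0; pose D := [set e.1 | e in U].
have cD : #|D| = #|U|.
  apply: card_in_imset => e f eU fU ef.
  apply: (matchingP (graph_matching s0)); rewrite ?(subsetP Us0) //.
  by rewrite ef eqxx.
have sub : [set s | U \subset graph s] \subset
    [set (t * s0)%g | t in perm_on (~: D)].
  apply/subsetP => s; rewrite inE => Us.
  apply/imsetP; exists (s * s0^-1)%g; last by rewrite mulgKV.
  apply/subsetP => i; rewrite !inE permM; apply: contra => /imsetP[e eU ->].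
  have := subsetP Us e eU; have := subsetP Us0 e eU; rewrite !inE => /eqP s0e /eqP ->.
  by rewrite -s0e permK.
rewrite (leq_trans (subset_leq_card sub)) // (leq_trans (leq_imset_card _ _)) //.
rewrite card_perm leq_fact //.
by rewrite cardsCs setCK cD card_ord leq_sub2l.
Qed.

Lemma card_smalls : #|[set A : {set edge} | small l A]| <= (m * m).+1 ^ l.
Proof.
(* A set of at most [l] edges fits into [l] slots, each holding an edge or nothing. *)
pose dec (f : {ffun 'I_l -> option edge}) : {set edge} :=
  [set e | [exists i, f i == Some e]].
have sub : [set A | small l A] \subset [set dec f | f in predT].
  apply/subsetP => A; rewrite inE => /andP[_ cA]; apply/imsetP.
  exists [ffun i : 'I_l => nth None [seq Some e | e <- enum A] i] => //.
  apply/setP => e; rewrite inE; apply/idP/existsP => [eA|[i]].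
    have ie : index e (enum A) < size (enum A) by rewrite index_mem mem_enum.
    have il : index e (enum A) < l by rewrite (leq_trans ie) // -cardE.
    exists (Ordinal il); rewrite ffunE /= (nth_map e) ?nth_index ?mem_enum //.
  rewrite ffunE; have [iA|iA] := ltnP i (size (enum A)).
    by rewrite (nth_map e) // => /eqP[<-]; rewrite -mem_enum mem_nth.
  by rewrite nth_default // size_map.
rewrite (leq_trans (subset_leq_card sub)) // (leq_trans (leq_imset_card _ _)) //.
by rewrite card_ffun card_option card_prod !card_ord.
Qed.

(** A colouring that makes [B] monochromatic is accepted through [A], so [B] is implied without
    error. *)
Lemma closed_up (W : family) (A B : {set edge}) :
  closed l r W -> A \in W -> A \subset B ->
  small l B -> B \in W.
Proof.
move=> [_ clW] AW AB sB; apply: clW => //.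
rewrite (_ : [set h | _] = set0) ?cards0 //.
apply/setP => h; rewrite !inE; apply/negP => /andP[Bh /negP]; apply.
by apply/acceptsP; exists A; rewrite ?(subset_trans AB).
Qed.

Lemma accepts_sub (W W' : family) G : W \subset W' -> accepts W G -> accepts W' G.
Proof.
move=> /subsetP WW' /acceptsP[A AW AG].
by apply/acceptsP; exists A; rewrite ?WW'.
Qed.

(** Almost implied matchings are added one at a time. Each costs at most a fraction 2^(-r) of the
    colourings, and [card_smalls] bounds their number. *)
Lemma closure (W : family) : (forall A, A \in W -> small l A) ->
  exists W' : family, [/\ closed l r W', W \subset W' &
    #|[set h | accepts W' (mono h) && ~~ accepts W (mono h)]| * 2 ^ r
      <= (m * m).+1 ^ l * 2 ^ (2 * m)].
Proof.
move=> sW; suff: exists W' : family, [/\ closed l r W', W \subset W' &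
    #|[set h | accepts W' (mono h) && ~~ accepts W (mono h)]| * 2 ^ r
      <= #|[set A | small l A] :\: W| * 2 ^ (2 * m)].
  case=> W' [clW' sub le]; exists W'; split=> //.
  rewrite (leq_trans le) // leq_mul2r (leq_trans _ card_smalls) ?orbT //.
  by rewrite subset_leq_card // subsetDl.
have [n] := ubnP #|[set A | small l A] :\: W|.
elim: n => // n IHn in W sW *; rewrite ltnS => Wn.
pose bad (Z : {set edge}) := [set h | (Z \subset mono h) && ~~ accepts W (mono h)].
have [Z /and3P[sZ ZW Zbad]|none] :=
    pickP (fun Z : {set edge} =>
      [&& small l Z, Z \notin W & #|bad Z| * 2 ^ r <= 2 ^ (2 * m)]).
  2: { exists W; split=> //; last first.
         rewrite (_ : [set h | _] = set0) ?cards0 //.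
         by apply/setP => h; rewrite !inE andbN.
       split=> // Z sZ Zle; have := none Z; rewrite sZ Zle andbT /=.
       by move/negbFE. }
have sW1 A : A \in Z |: W -> small l A by rewrite !inE => /orP[/eqP ->|/sW].
have cW : #|[set A | small l A] :\: W| = #|[set A | small l A] :\: (Z |: W)|.+1.
  rewrite (cardsD1 Z) in_setD ZW inE sZ add1n; congr _.+1.
  by apply: eq_card => A; rewrite !inE negb_or andbA.
have [|W' [clW' sub le]] := IHn _ sW1; first by rewrite -ltnS -cW.
exists W'; split => //; first by apply: subset_trans sub; apply: subsetUr.
rewrite cW mulSn addnC; apply: leq_trans (leq_add le Zbad); rewrite -mulnDl.
rewrite leq_mul2r; apply/orP; right.
apply: leq_trans (leq_card_setU _ _); apply/subset_leq_card/subsetP => h.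
rewrite !inE => /andP[-> nW]; rewrite nW andbT /=.
have [/acceptsP[A]|//] := boolP (accepts (Z |: W) (mono h)).
rewrite !inE => /orP[/eqP ->|AW Ah]; first by [].
by case/acceptsP: nW; exists A.
Qed.

Lemma closedI (W1 W2 : family) :
  closed l r W1 -> closed l r W2 -> closed l r (W1 :&: W2).
Proof.
move=> [s1 c1] [s2 c2]; split=> [A|Z sZ le].
  by rewrite inE => /andP[/s1].
rewrite inE c1 ?c2 // (leq_trans _ le) // leq_mul2r subset_leq_card ?orbT //;
  apply/subsetP => h; rewrite !inE => /andP[-> /=]; apply: contra;
  apply: accepts_sub; [exact: subsetIr | exact: subsetIl].
Qed.

(* A lost permutation contains minimal [A] and [B] whose union has at least
   [l] edges, as otherwise [A :|: B] would lie in both families. *)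
Lemma lost_by_setI (W1 W2 : family) : closed l r W1 -> closed l r W2 ->
  #|[set s | [&& accepts W1 (graph s), accepts W2 (graph s) &
                 ~~ accepts (W1 :&: W2) (graph s)]]|
    <= #|minimal W1| * #|minimal W2| * (m - l)`!.
Proof.
move=> c1 c2; set S := [set s | _].
pose over A B := [set s | [&& l <= #|A :|: B| & (A :|: B) \subset graph s]].
have sub : S \subset \bigcup_(A in minimal W1) \bigcup_(B in minimal W2) over A B.
  apply/subsetP => s; rewrite inE => /and3P[/acceptsP[A1 A1W A1s]].
  move=> /acceptsP[B1 B1W B1s] nW.
  have [A AM AA1] := minimal_below A1W; have [B BM BB1] := minimal_below B1W.
  have ABs : (A :|: B) \subset graph s.
    by rewrite subUset (subset_trans AA1) // (subset_trans BB1).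
  apply/bigcupP; exists A => //; apply/bigcupP; exists B => //.
  rewrite inE ABs andbT leqNgt; apply: contra nW => lt.
  have sAB : small l (A :|: B).
    by rewrite /small (matching_sub ABs (graph_matching s)) ltnW.
  apply/acceptsP; exists (A :|: B) => //; rewrite inE.
  move: AM BM; rewrite !inE => /andP[AW _] /andP[BW _].
  by rewrite (closed_up c1 AW) ?subsetUl // (closed_up c2 BW) ?subsetUr.
rewrite (leq_trans (subset_leq_card sub)) // -mulnA.
apply: leq_card_bigcup => A _; apply: leq_card_bigcup => B _.
have [lAB|ABl] := leqP l #|A :|: B|; last first.
  rewrite (_ : over A B = set0) ?cards0 //.
  by apply/setP => s; rewrite !inE leqNgt ABl.
rewrite (leq_trans _ (card_graph_superset lAB)) //.
by apply/subset_leq_card/subsetP => s; rewrite !inE => /andP[].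
Qed.
End Operations.

(** * Approximation of layered monotone circuits *)

Section Circuits.
Variables m l r : nat.
Local Notation edge := ('I_m * 'I_m)%type.
Local Notation vertex := ('I_m + 'I_m)%type.
Local Notation family := {set {set edge}}.
Local Notation perms := {set {perm 'I_m}}.
Local Notation colourings := {set {set vertex}}.

(* [P] and [N] collect the positive and negative tests lost so far by the whole
   circuit, so that shared gates are charged only once. *)
Definition approx (W : family) (f : {set edge} -> bool)
    (P : perms) (N : colourings) : Prop :=
  [/\ closed l r W,
      forall s, s \notin P -> f (graph s) -> accepts W (graph s) &
      forall h, h \notin N -> accepts W (mono h) -> f (mono h)].

(** Losses of a single gate: [and_loss] comes from [lost_by_setI] and [card_minimal], [or_loss] from
    [closure]. The latter bounds lost colourings times [2 ^ r], which avoids fractions. *)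
Definition and_loss := (branching l r ^ (2 * l)) ^ 2 * (m - l)`!.
Definition or_loss := (m * m).+1 ^ l * 2 ^ (2 * m).

Definition cost k (P : perms) (N : colourings) : Prop :=
  #|P| <= k * and_loss /\ #|N| * 2 ^ r <= k * or_loss.

Lemma cost0 : cost 0 set0 set0.
Proof. by rewrite /cost !cards0. Qed.

Lemma costW j k P N : j <= k -> cost j P N -> cost k P N.
Proof.
by move=> jk [cP cN]; split; [apply: leq_trans cP _|apply: leq_trans cN _];
   rewrite leq_mul2r jk orbT.
Qed.

Lemma costU j k P1 N1 P2 N2 :
  cost j P1 N1 -> cost k P2 N2 -> cost (j + k) (P1 :|: P2) (N1 :|: N2).
Proof.
move=> [p1 n1] [p2 n2]; split.
  by rewrite mulnDl (leq_trans (leq_card_setU _ _)) ?leq_add.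
rewrite mulnDl (leq_trans _ (leq_add n1 n2)) // -mulnDl leq_mul2r.
by rewrite leq_card_setU orbT.
Qed.

Lemma approxS W f (P P' : perms) (N N' : colourings) :
  P \subset P' -> N \subset N' -> approx W f P N -> approx W f P' N'.
Proof.
move=> /subsetP PP /subsetP NN [cW fP fN]; split=> // [s|h] sn.
  by apply: fP; apply: contra sn; apply: PP.
by apply: fN; apply: contra sn; apply: NN.
Qed.

Lemma approx_ext W f g P N : f =1 g -> approx W f P N -> approx W g P N.
Proof.
by move=> fg [cW fP fN]; split=> // [s|h] sn; rewrite -fg; [exact: fP|exact: fN].
Qed.

Lemma approx_true :
  approx [set A | small l A] (fun=> true) set0 set0.
Proof.
split=> //; last first.
  move=> s _ _; apply/acceptsP; exists set0; last exact: sub0set.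
  rewrite inE /small cards0 (matching_sub (sub0set _) (graph_matching s)).
  by [].
by split=> [A|Z sZ _]; rewrite inE.
Qed.

Lemma approx_closure (W : family) (f : {set edge} -> bool)
    (P : perms) (N : colourings) :
  (forall A, A \in W -> small l A) ->
  (forall s, s \notin P -> f (graph s) -> accepts W (graph s)) ->
  (forall h, h \notin N -> accepts W (mono h) -> f (mono h)) ->
  exists W' N', cost 1 set0 N' /\ approx W' f P (N :|: N').
Proof.
move=> sW fP fN; have [W' [clW' WW' le]] := closure r sW.
exists W', [set h | accepts W' (mono h) && ~~ accepts W (mono h)]; split.
  by split; rewrite ?cards0 // mul1n.
split=> // [s sP fs|h]; first exact: accepts_sub WW' (fP s sP fs).
by rewrite !inE => /norP[hN + aW']; rewrite aW' negbK; apply: fN.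
Qed.

Lemma approx_edge (e : edge) : 0 < l ->
  exists W N, cost 1 set0 N /\ approx W (fun G => e \in G) set0 N.
Proof.
move=> l0; have [|||W' [N' [cN' aW']]] := @approx_closure [set [set e]]
  (fun G => e \in G) set0 set0.
- move=> A; rewrite inE => /eqP ->; rewrite /small cards1 l0 andbT.
  apply/forallP => a; apply/implyP; rewrite inE => /eqP ->.
  apply/forallP => b; apply/implyP; rewrite inE => /eqP ->.
  by rewrite !eqxx.
- by move=> s _ es; apply/acceptsP; exists [set e]; rewrite ?inE ?sub1set.
- by move=> h _ /acceptsP[A]; rewrite inE => /eqP ->; rewrite sub1set.
by exists W', N'; rewrite -[N']set0U; split => //; rewrite set0U.
Qed.

(** Uniting the families makes no new error; only the closure does, once for any fan-in. *)
Lemma approx_or (L : finType) (Y : {set L}) (f : L -> {set edge} -> bool) P N :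
  (forall y, exists W, approx W (f y) P N) ->
  exists W' N', cost 1 set0 N' /\
    approx W' (fun G => [exists y in Y, f y G]) P (N :|: N').
Proof.
move=> /fin_all_exists[W aW].
apply: (@approx_closure (\bigcup_(y in Y) W y)).
- by move=> A /bigcupP[y _ AW]; have [[sW _] _ _] := aW y; apply: sW.
- move=> s sP /existsP[y /andP[yY fy]]; have [_ + _] := aW y.
  move=> /(_ s sP fy); apply: accepts_sub; exact: bigcup_sup yY.
- move=> h hN /acceptsP[A /bigcupP[y yY AW] Ah]; apply/existsP; exists y.
  by rewrite yY; have [_ _] := aW y; apply=> //; apply/acceptsP; exists A.
Qed.

Lemma approx_and W1 W2 f1 f2 P N :
  approx W1 f1 P N -> approx W2 f2 P N ->
  exists P', cost 1 P' set0 /\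
    approx (W1 :&: W2) (fun G => f1 G && f2 G) (P :|: P') N.
Proof.
move=> [c1 p1 n1] [c2 p2 n2].
exists [set s | [&& accepts W1 (graph s), accepts W2 (graph s) &
                 ~~ accepts (W1 :&: W2) (graph s)]]; split.
  split; last by rewrite cards0.
  rewrite mul1n (leq_trans (lost_by_setI c1 c2)) // leq_mul2r expnS expn1.
  by rewrite leq_mul ?orbT // card_minimal.
split; first exact: closedI.
  move=> s; rewrite !inE => /norP[sP nP] /andP[/(p1 s sP) a1 /(p2 s sP) a2].
  by move: nP; rewrite a1 a2 negbK.
move=> h hN a; rewrite n1 // ?n2 //; apply: accepts_sub a.
  exact: subsetIr.
exact: subsetIl.
Qed.

Lemma approx_gate (L : finType) (rs : seq {set L}) (f : L -> {set edge} -> bool)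
    W0 f0 P N :
  (forall y, exists W, approx W (f y) P N) -> approx W0 f0 P N ->
  exists W' P' N', cost (size rs) P' N' /\
    approx W' (fun G => f0 G && all (fun Y : {set L} => [exists y in Y, f y G]) rs)
      (P :|: P') (N :|: N').
Proof.
move=> aW a0; elim: rs => [|Y rs [W1 [P1 [N1 [c1 a1]]]]] /=.
  exists W0, set0, set0; split; first exact: cost0.
  by rewrite !setU0; apply: approx_ext a0 => G; rewrite andbT.
have [W2 [N2 [c2 a2]]] := approx_or Y aW.
have a1' := approxS (subxx _) (subsetUl _ N2) a1.
have a2' := approxS (subsetUl P P1) (setSU N2 (subsetUl N N1)) a2.
have [P3 [c3 a3]] := approx_and a2' a1'.
exists (W2 :&: W1), (P1 :|: P3), (N1 :|: N2); split; last first.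
  by rewrite !setUA; apply: approx_ext a3 => G /=; rewrite andbCA.
(* One unit of cost pays both for the permutations lost by the conjunction and for the colourings
   lost by the disjunction. *)
by rewrite -addn1; apply: costU c1 (conj (proj1 c3) (proj2 c2)).
Qed.

(** Intended reading: [x] is still underived after [t] rounds of unit propagation. Each [Y] in
    [rules x] is a set of premises that together yield [x], so one of them must be underived a round
    earlier. *)
Fixpoint layer (L : finType) (init : L -> option edge) (rules : L -> seq {set L})
    t x (G : {set edge}) : bool :=
  if t is t'.+1 then
    (if init x is Some e then e \in G else true) &&
    all (fun Y : {set L} => [exists y in Y, layer init rules t' y G]) (rules x)
  else true.

Lemma approx_layer (L : finType) (init : L -> option edge)
    (rules : L -> seq {set L}) rho t :
  0 < l -> (forall x, size (rules x) < rho) ->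
  exists P N, cost (t * (#|L| * rho)) P N /\
    forall x, exists W, approx W (layer init rules t x) P N.
Proof.
move=> l0 rulesrho; elim: t => [|t [P [N [cPN aW]]]].
  exists set0, set0; split; first exact: cost0.
  by move=> x; exists [set A | small l A]; exact: approx_true.
suff /(_ (enum L)) [P' [N' [c' a']]] : forall xs : seq L, exists P' N',
    cost (size xs * rho) P' N' /\ forall x, x \in xs ->
      exists W, approx W (layer init rules t.+1 x) (P :|: P') (N :|: N').
  exists (P :|: P'), (N :|: N'); split; last by move=> x; apply: a'; rewrite mem_enum.
  by rewrite mulSn addnC; apply: costU => //; move: c'; rewrite -cardE.
elim=> [|x xs [P1 [N1 [c1 a1]]]]; first by exists set0, set0; split; first exact: cost0.
have [W0 [N0 [c0 a0]]] : exists W N0, cost 1 set0 N0 /\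
    approx W (fun G => if init x is Some e then e \in G else true) set0 N0.
  case: (init x) => [e|]; first exact: approx_edge.
  exists [set A | small l A], set0; split; last exact: approx_true.
  by apply: costW cost0.
have aW' y : exists W, approx W (layer init rules t y) P (N :|: N0).
  by have [W a] := aW y; exists W; apply: approxS a; rewrite ?subsetUl.
have a0' : approx W0 (fun G => if init x is Some e then e \in G else true) P (N :|: N0).
  by apply: approxS a0; rewrite ?sub0set ?subsetUr.
have [W2 [P2 [N2 [c2 a2]]]] := approx_gate (rules x) aW' a0'.
exists (P2 :|: P1), ((N0 :|: N2) :|: N1); split.
  (* The strict bound on [size (rules x)] leaves one unit of [rho] for the input edge. *)
  rewrite /= mulSn; apply: costU => //; rewrite -[P2]set0U.
  by apply: costW (costU c0 c2); rewrite add1n.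
move=> y; rewrite inE => /orP[/eqP ->|yxs].
  exists W2; apply: approxS a2; first by rewrite setUS ?subsetUl.
  by apply/subsetP => h; rewrite !inE => /orP[/orP[]|] ->; rewrite ?orbT.
have [W a] := a1 y yxs; exists W; apply: approxS a; rewrite setUS //;
  by rewrite ?subsetUr.
Qed.

(** Intended reading: no clause is falsified after [t] rounds, each goal being the set of literals
    whose derivation falsifies one clause. *)
Definition output (L : finType) (init : L -> option edge) (rules : L -> seq {set L})
    t (goals : seq {set L}) (G : {set edge}) : bool :=
  all (fun Y : {set L} => [exists y in Y, layer init rules t y G]) goals.

(* Uncolour the ends of [Z] and use a spare vertex to repair the parity. *)
Lemma odd_mono_many (Z : {set edge}) : l < m -> #|Z| <= l ->
  2 ^ (2 * m) <= #|[set h :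
    {set vertex} | odd #|h| && (Z \subset mono h)]| * 2 ^ (2 * l).+1.
Proof.
move=> lm cZ; have cE : #|ends Z| <= 2 * l.
  by rewrite (leq_trans (card_ends _)) // leq_mul2l cZ orbT.
have [v vE] : exists v, v \in ~: ends Z.
  apply/set0Pn; rewrite -card_gt0 cardsCs setCK card_sum card_ord addnn -mul2n.
  by rewrite subn_gt0 (leq_ltn_trans cE) // ltn_mul2l.
rewrite inE in vE.
pose D := v |: ends Z.
have cD : #|D| <= (2 * l).+1 by rewrite cardsU1 vE ltnS.
pose g (h : {set vertex}) := if odd #|h :\: D| then h :\: D else v |: (h :\: D).
have -> : 2 ^ (2 * m) = #|[set: {set vertex}]|.
  by rewrite -powersetT card_powerset cardsT card_sum card_ord addnn mul2n.
apply: (@leq_trans (#|[set h :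
  {set vertex} | odd #|h| && (Z \subset mono h)]| * 2 ^ #|D|)).
  2: by rewrite leq_mul2l leq_exp2l ?cD ?orbT.
apply: (card_refit (g := g)) => h.
  move=> _; rewrite inE; apply/andP; split.
    rewrite /g; case: ifP => // ev.
    by rewrite cardsU1 !inE eqxx /= ev.
  apply/subsetP => e eZ; rewrite inE.
  have out w : w \in ends Z -> (w \in g h) = false.
    move=> wE; have wv : w == v = false.
      by apply/negbTE; apply: contra vE => /eqP <-.
    have wD : w \in D by rewrite in_setU wE orbT.
    by rewrite /g; case: ifP => _; rewrite ?in_setU1 ?wv in_setD wD.
  by rewrite !out ?src_ends ?tgt_ends.
apply/setP => w; rewrite /g; case: ifP => _; rewrite !inE;
  by case: (w == v); rewrite /= ?andbA ?andbb.
Qed.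

(** If the final approximator is empty, all m! permutations are lost. If it has a member [Z], all
    odd colourings with [Z] monochromatic are wrongly accepted, and [odd_mono_many] shows that these
    are many. *)
Lemma matching_circuit_bound (L : finType) (init : L -> option edge)
    (rules : L -> seq {set L}) t (goals : seq {set L}) rho n :
  0 < l < m -> (forall x, size (rules x) < rho) ->
  t * (#|L| * rho) + size goals <= n ->
  (forall s, output init rules t goals (graph s)) ->
  (forall h : {set vertex}, odd #|h| -> ~~ output init rules t goals (mono h)) ->
  m ^_ l <= n * (branching l r ^ (2 * l)) ^ 2 \/
  2 ^ r <= n * ((m * m).+1 ^ l * 2 ^ (2 * l).+1).
Proof.
case/andP=> l0 lm rulesrho ln pos neg.
have [P [N [c1 a1]]] := approx_layer init t l0 rulesrho.
have [W [P2 [N2 [c2 a2]]]] := approx_gate goals a1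
  (approxS (sub0set P) (sub0set N) approx_true).
have [cP cN] := costW ln (costU c1 c2).
case: a2 => clW aP aN.
have [W0|[Z ZW]] := set_0Vmem W; [left|right].
  rewrite -(leq_pmul2r (fact_gt0 (m - l))) ffact_fact ?(ltnW lm) // -mulnA;
    apply: leq_trans cP.
  rewrite -card_Sn -cardsT subset_leq_card //; apply/subsetP => s _.
  apply/negPn/negP => sP; have := aP s sP (pos s).
  by rewrite W0 => /acceptsP[A]; rewrite inE.
have cZ : #|Z| <= l by case: clW => /(_ Z ZW) /andP[].
have sub : [set h : {set vertex} | odd #|h| && (Z \subset mono h)] \subset N :|: N2.
  apply/subsetP => h; rewrite inE => /andP[odd_h Zh]; apply/negPn/negP => hN.
  have /negP := neg h odd_h; apply; apply: aN => //.
  by apply/acceptsP; exists Z.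
have lost := leq_trans (leq_mul (subset_leq_card sub) (leqnn (2 ^ r))) cN.
have p0 : 0 < 2 ^ (2 * m) by rewrite expn_gt0.
rewrite -(leq_pmul2r p0).
apply: leq_trans (leq_mul (leqnn (2 ^ r)) (odd_mono_many lm cZ)) _.
rewrite mulnA [2 ^ r * _]mulnC.
apply: leq_trans (leq_mul lost (leqnn _)) _.
by rewrite /or_loss -!mulnA [2 ^ (2 * m) * _]mulnC.
Qed.
End Circuits.

(** * Resolution and hardness *)

Section Resolution.
Local Open Scope fset_scope.
Local Open Scope fmap_scope.
Variable T : choiceType.
Implicit Types (F : {fset {fset literal T}}) (C D E : {fset literal T})
  (phi psi : {fmap T -> bool}) (x y z : literal T).

Lemma complK : involutive (@compl T).
Proof. by case=> v b; rewrite /compl negbK. Qed.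

Lemma in_compls C x : (x \in compls C) = (compl x \in C).
Proof.
apply/imfsetP/idP => [[y /= yC ->]|xC]; first by rewrite complK.
by exists (compl x); rewrite ?complK.
Qed.

Lemma clause_compl C x : is_clause C -> x \in C -> compl x \notin C.
Proof. by move=> /fdisjointP h /h; rewrite in_compls. Qed.

Lemma falsified_clause C (a : T -> bool) :
  (forall x, x \in C -> x.2 = ~~ a x.1) -> is_clause C.
Proof.
move=> Ca; apply/fdisjointP => x xC; rewrite in_compls; apply/negP => /Ca /=.
by rewrite (Ca x xC); case: (a _).
Qed.

Lemma in_vars F C x : C \in F -> x \in C -> x.1 \in vars F.
Proof. by move=> CF xC; apply/imfset2P; exists C => //; exists x. Qed.

Lemma apply_pa_eq0 phi F :
  apply_pa phi F = fset0 <-> forall C, C \in F -> satisfies_clause phi C.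
Proof.
split=> [F0 C CF|Fs].
  apply/negPn/negP => Cn.
  suff : [fset x in C | lit_val phi x != Some false] \in apply_pa phi F.
    by rewrite F0.
  by apply/imfsetP; exists C; rewrite //= inE /= CF Cn.
apply/fsetP => D; rewrite in_fset0; apply/negP => /imfsetP[C /=].
by rewrite inE /= => /andP[/Fs -> ].
Qed.

(** Completeness of resolution; it ensures that [hd] of an unsatisfiable clause-set is attained and
    not a default value. *)
Lemma refutation_exists F : is_clause_set F -> unsat F ->
  exists t, is_refutation F t.
Proof.
move=> clF unF.
(* The variables in [s] have been eliminated: the label avoids them and is false under [a]. To
   eliminate [v] as well, the trees for both values of [v] are resolved, unless one label already
   avoids [v]. *)
suff /(_ (vars F) (fun=> true)) [t [tF _ tP]] : forall (s : seq T) (a : T -> bool),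
    exists t, [/\ is_resolution_tree F t, is_clause (label t) &
      forall x, x \in label t -> [/\ x.1 \notin s, x.1 \in vars F & x.2 = ~~ a x.1]].
  exists t; split => //; apply/fsetP => x; rewrite in_fset0; apply/negP => /tP.
  by case=> /negP.
elim=> [|v s IHs] a.
  pose phi := [fmap v : vars F => a (val v)].
  have [C CF Cn] : exists2 C, C \in F & ~~ satisfies_clause phi C.
    apply: contrapT => none; apply: (unF phi); apply/apply_pa_eq0 => C CF.
    by apply/negPn/negP => Cn; apply: none; exists C.
  exists (RLeaf C); split=> /=; [by split; first exact: clF|exact: clF|].
  move=> x xC; have xF := in_vars CF xC; split => //.
  apply/eqP; rewrite -addbT -[_ == _]negbK; apply: contra Cn => xa.
  apply/hasP; exists x => //; rewrite /lit_val.
  have -> : phi.[? x.1] = Some (a x.1) by rewrite (in_fnd (f := phi) xF) ffunE.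
  by move: xa; case: (x.2); case: (a x.1).
have [t1 [t1F t1c t1P]] := IHs (fun u => if u == v then true else a u).
have [t2 [t2F t2c t2P]] := IHs (fun u => if u == v then false else a u).
have [v1|v1] := boolP ((v, false) \in label t1); last first.
  exists t1; split=> // x xt; have [xs xF] := t1P x xt; have [xv|xv] := eqVneq x.1 v.
    by move=> x2; case/negP: v1; rewrite -xv -[false]x2 -surjective_pairing.
  by move=> x2; split; rewrite // inE negb_or xv.
have [v2|v2] := boolP ((v, true) \in label t2); last first.
  exists t2; split=> // x xt; have [xs xF] := t2P x xt; have [xv|xv] := eqVneq x.1 v.
    by move=> x2; case/negP: v2; rewrite -xv -[true]x2 -surjective_pairing.
  by move=> x2; split; rewrite // inE negb_or xv.
pose E := (label t1 `|` label t2) `\` [fset (v, false); (v, true)].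
have EP x : x \in E -> [/\ x.1 \notin v :: s, x.1 \in vars F & x.2 = ~~ a x.1].
  rewrite !inE negb_or => /andP[/andP[x1 x2] xE].
  have xv : x.1 != v.
    by move: x1 x2; case: (x) => w []; rewrite !xpair_eqE /= ?andbT ?andbF.
  by case/orP: xE => [/t1P|/t2P]; rewrite (negbTE xv) => -[xs xF xa]; split;
    rewrite // inE negb_or xv.
exists (RNode E t1 t2); split=> //=; last first.
  by apply: (falsified_clause (a := a)) => x /EP[].
split=> //; first by apply: (falsified_clause (a := a)) => x /EP[].
(* Away from [v] both labels are false under the same [a], so they clash in [v] only. *)
exists (v, false); split=> //; apply/fsetP => x; rewrite !inE in_compls.
apply/andP/eqP => [[/t1P[_ _ x1] /t2P[_ _]]|->]; last by [].
move: x1 => /=; case: (x) => w b /=; case: eqVneq => [-> -> //|_ ->].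
by case: (a w).
Qed.

(* [der] is the set of literals derived by unit propagation. *)
Lemma unit_propagation_refutes F phi (der : literal T -> bool) t :
  (forall v b, phi.[? v] = Some b -> der (v, b)) ->
  (forall C x, C \in F -> x \in C ->
     (forall y, y \in C -> y != x -> der (compl y)) -> der x) ->
  is_resolution_tree (apply_pa phi F) t -> hts t <= 1 ->
  (forall y, y \in label t -> der (compl y)) ->
  exists2 C, C \in F & forall y, y \in C -> der (compl y).
Proof.
move=> der0 der1.
have clause_label u : is_resolution_tree (apply_pa phi F) u -> is_clause (label u).
  by case: u => [C [] | C u1 u2 []].
have hts0 u : hts u = 0 -> exists C, u = RLeaf C.
  case: u => [C|C u1 u2] /=; first by exists C.
  by case: ifP => // /eqP ne /eqP;
    rewrite -leqn0 geq_max !leqn0 => /andP[/eqP a /eqP b]; case: ne; rewrite a b.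
have restr L : L \in apply_pa phi F -> exists2 C, C \in F &
    L `<=` C /\ forall y, y \in C -> y \in L \/ der (compl y).
  case/imfsetP=> C /=; rewrite inE /= => /andP[CF _] ->; exists C => //; split.
    by apply/fsubsetP => y; rewrite !inE => /andP[].
  move=> y yC; have [yf|yf] := eqVneq (lit_val phi y) (Some false).
    right; apply: der0; move: yf; rewrite /lit_val.
    by case: phi.[? y.1] => [b|] //= [/eqP]; case: (y.2) b => [] [].
  by left; rewrite !inE yC yf.
have unit_leaf L z : L \in apply_pa phi F -> z \in L ->
    (forall y, y \in L -> y != z -> der (compl y)) -> der z.
  move=> /restr[C CF [/fsubsetP LC CL]] zL Lz.
  apply: (der1 C z CF (LC z zL)) => y yC yz.
  by case: (CL y yC) => // yL; apply: Lz.
elim: t => [L [_ /restr[C CF [_ CL]]] _ Lf|E t1 IH1 t2 IH2] /=.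
  by exists C => // y /CL[/Lf|].
case=> _ [x [xx ->]] r1 r2 h f.
have /fsetP/(_ x) := xx; rewrite !inE eqxx in_compls => /andP[x1 x2].
have c1 := clause_label _ r1; have c2 := clause_label _ r2.
have nx1 := clause_compl c1 x1; have := clause_compl c2 x2; rewrite complK => nx2.
have f1 y : y \in label t1 -> y != x -> der (compl y).
  move=> y1 yx; apply: f; rewrite !inE y1 (negbTE yx) /= andbT.
  by apply: contraNneq nx1 => <-.
have f2 y : y \in label t2 -> y != compl x -> der (compl y).
  move=> y2 yx; apply: f; rewrite !inE y2 (negbTE yx) orbT andbT orbF.
  by apply: contraNneq nx2 => <-.
(* One child is a leaf. All its literals except the resolved one are refuted, so it acts as a unit
   clause and derives that literal; then the label of the other child is refuted entirely, and the
   descent continues there. *)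
have [/hts0[L tL]|/hts0[L tL]] : hts t1 = 0 \/ hts t2 = 0.
- move: h; case: ifP => [_|/eqP + /[!geq_max]/andP[]].
    by rewrite ltnS leqn0 => /eqP; left.
  by case: (hts t1) (hts t2) => [|[|a]] [|[|b]] // ne _ _; auto; case: ne.
- have dx : der x by apply: (unit_leaf L); move: r1 x1 f1; rewrite tL //= => -[].
  apply: IH2 => // [|y y2].
    by move: h; case: ifP => [/eqP <- /ltnW //|_]; rewrite geq_max => /andP[].
  by have [->|/f2] := eqVneq y (compl x); rewrite ?complK //; apply.
- have dx : der (compl x).
    by apply: (unit_leaf L); move: r2 x2 f2; rewrite tL //= => -[].
  apply: IH1 => // [|y y1].
    by move: h; case: ifP => [_ /ltnW //|_]; rewrite geq_max => /andP[].
  by have [->|/f1] := eqVneq y x => //; apply.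
Qed.

Lemma apply_pa_clause_set phi F : is_clause_set F -> is_clause_set (apply_pa phi F).
Proof.
move=> clF D /imfsetP[C /=]; rewrite inE /= => /andP[/clF Cc _] ->.
apply/fdisjointP => x; rewrite in_compls !inE => /andP[xC _].
by rewrite (negbTE (clause_compl Cc xC)).
Qed.

Lemma ex_minimum (A : nat -> Prop) k : A k -> exists j, A j /\ forall i, A i -> j <= i.
Proof.
move=> Ak; have ex : exists k, `[< A k >] by exists k; apply/asboolP.
have [j /asboolP Aj jmin] := ex_minnP ex.
by exists j; split=> // i Ai; apply: jmin; apply/asboolP.
Qed.

Lemma ex_maximum (A : nat -> Prop) k b : A k -> (forall i, A i -> i <= b) ->
  exists j, A j /\ forall i, A i -> i <= j.
Proof.
move=> Ak Ab; have ex : exists k, `[< A k >] by exists k; apply/asboolP.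
have ub i : `[< A i >] -> i <= b by move/asboolP/Ab.
have [j /asboolP Aj jmax] := ex_maxnP ex ub.
by exists j; split=> // i Ai; apply: jmax; apply/asboolP.
Qed.

Lemma hd_attained F : is_clause_set F -> unsat F ->
  exists2 t, is_refutation F t & hts t = hd F.
Proof.
move=> clF unF; have [t tF] := refutation_exists clF unF.
have [|j jP] := @ex_minimum (fun k => exists2 t, is_refutation F t & hts t = k) (hts t).
  by exists t.
rewrite /hd; case: xgetP => [k _ [[u uF <-] _]|/(_ j)/(_ jP)] //.
by exists u.
Qed.

Lemma hd_le_hdV (V : {fset T}) F phi : domf phi `<=` V ->
  unsat (apply_pa phi F) -> hd (apply_pa phi F) <= hdV V F.
Proof.
move=> phiV un; rewrite /hdV; case: eqP => [F0|_].
  by case: (un phi); apply/apply_pa_eq0 => C /imfsetP[D /=]; rewrite F0 inE.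
pose A k := exists psi : {fmap T -> bool},
  [/\ domf psi `<=` V, unsat (apply_pa psi F) & hd (apply_pa psi F) = k].
(* Coding assignments inside [V] by a finite function type bounds [A], so the maximum in [hdV]
   exists. *)
pose code psi : {ffun V -> option bool} := [ffun v => psi.[? val v]].
pose decode f := xget phi [set psi | (domf psi `<=` V)%fset /\ code psi = f]%classic.
have decodeK psi : domf psi `<=` V -> decode (code psi) = psi.
  move=> psiV; rewrite /decode; case: xgetP => [chi _ [chiV e]|/(_ psi)[]//].
  apply/fmapP => v; have [vV|vV] := boolP (v \in V).
    by move/ffunP/(_ [` vV]): e; rewrite !ffunE.
  by rewrite !not_fnd //; apply: contra vV; apply: fsubsetP.
have Aphi : A (hd (apply_pa phi F)) by exists phi.
have [i [psi [psiV _ <-]]|j jP] := ex_maximum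
    (b := \max_(f : {ffun V -> option bool}) hd (apply_pa (decode f) F)) Aphi.
  by rewrite -[X in apply_pa X]decodeK // (leq_bigmax (code psi)).
by case: xgetP => [k _ [_ /(_ _ Aphi)]|/(_ j)/(_ jP)].
Qed.
End Resolution.

(** * Unit propagation as a monotone circuit *)

(** The permutation pairs the left vertices in [h] with the right ones. *)
Lemma even_colouring m (h : {set 'I_m + 'I_m}) (s : {perm 'I_m}) :
  graph s \subset mono h -> ~~ odd #|h|.
Proof.
move=> /subsetP sh; rewrite -sum1_card big_sumType /=.
rewrite [X in (_ + X)%N](reindex_inj (@perm_inj _ s)) /=.
rewrite [X in (_ + X)%N](eq_bigl (fun i => inl i \in h)) => [|i]; last first.
  by have := sh (i, s i); rewrite !inE eqxx => /(_ isT)/eqP <-.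
by rewrite addnn odd_double.
Qed.

Section Pigeonhole.
Local Open Scope fset_scope.
Local Open Scope fmap_scope.
Variables (T : choiceType) (m : nat) (p : 'I_m * 'I_m -> T).
Hypothesis p_inj : injective p.

Lemma in_php_vars e : p e \in php_vars p.
Proof. by apply/imfsetP; exists e. Qed.

Lemma php_row i : [fset pos (p (i, j)) | j : 'I_m] \in PHP p.
Proof. by rewrite in_fsetU; apply/orP; left; apply/imfsetP; exists i. Qed.

Lemma php_col i1 i2 j : i1 != i2 ->
  [fset neg (p (i1, j)); neg (p (i2, j))] \in PHP p.
Proof.
move=> ne; rewrite in_fsetU; apply/orP; right; apply/imfsetP.
by exists (i1, i2, j).
Qed.

Lemma vars_php : vars (PHP p) = php_vars p.
Proof.
apply/fsetP => v; apply/imfset2P/imfsetP => [[C /= CF [x xC ->]]|[[i j] _ ->]].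
  move: CF; rewrite in_fsetU => /orP[] /imfsetP[].
    by move=> i /= _ CE; move: xC; rewrite CE => /imfsetP[j /= _ ->]; exists (i, j).
  move=> [[i1 i2] j] /= _ CE; move: xC; rewrite CE !inE.
  by case/orP=> /eqP ->; [exists (i1, j)|exists (i2, j)].
exists [fset pos (p (i, j')) | j' : 'I_m]; first exact: php_row.
by exists (pos (p (i, j))) => //; apply/imfsetP; exists j.
Qed.

Definition perm_assignment (s : {perm 'I_m}) : {fmap T -> bool} :=
  [fmap v : php_vars p => [exists i, val v == p (i, s i)]].

Lemma perm_assignmentE s i j :
  (perm_assignment s).[? p (i, j)] = Some (s i == j).
Proof.
rewrite (in_fnd (f := perm_assignment s) (in_php_vars (i, j))) ffunE /=; congr Some.
apply/existsP/eqP => [[k /eqP/p_inj[-> ->]]|<-] //.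
by exists i.
Qed.

Lemma perm_assignment_sat s : total_sat (PHP p) (perm_assignment s).
Proof.
split; first by rewrite vars_php.
apply/apply_pa_eq0 => C; rewrite in_fsetU => /orP[] /imfsetP[].
  move=> i /= _ ->; apply/hasP; exists (pos (p (i, s i))).
    by apply/imfsetP; exists (s i).
  by rewrite /lit_val perm_assignmentE /= eqxx.
move=> [[i1 i2] j] /= ne ->; apply/hasP.
have [s1|s1] := eqVneq (s i1) j.
  exists (neg (p (i2, j))); first by rewrite !inE eqxx orbT.
  rewrite /lit_val perm_assignmentE /= -s1 (inj_eq perm_inj).
  by move: ne; rewrite inE /= eq_sym => /negbTE ->.
exists (neg (p (i1, j))); first by rewrite !inE eqxx.
by rewrite /lit_val perm_assignmentE /= (negbTE s1).
Qed.

(** The row clauses choose a function, and the column clauses make it injective. *)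
Lemma sat_perm (psi : {fmap T -> bool}) : apply_pa psi (PHP p) = fset0 ->
  exists s : {perm 'I_m}, forall i, psi.[? p (i, s i)] = Some true.
Proof.
move=> /apply_pa_eq0 sat.
have /fin_all_exists[f fP] i : exists j, psi.[? p (i, j)] = Some true.
  have /hasP[x /imfsetP[j /= _ ->]] := sat _ (php_row i).
  by rewrite /lit_val /=; case E : psi.[? _] => [[]|] // _; exists j.
have f_inj : injective f.
  move=> i1 i2 f12; apply: contraTeq isT => /(php_col (f i1))/sat/hasP[x].
  by rewrite !inE => /orP[]/eqP ->; rewrite /lit_val /= ?fP // f12 fP.
by exists (perm f_inj) => i; rewrite permE.
Qed.

Variable F : {fset {fset literal T}}.
Local Notation L := (vars F * bool)%type.
Local Notation edge := ('I_m * 'I_m)%type.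

Definition lit (y : L) : literal T := (val y.1, y.2).

(* The negated edge variables are the inputs: [neg (p e)] is derived at once
   exactly when [e] is missing from the graph. *)
Definition init (y : L) : option edge := [pick e | lit y == neg (p e)].

Definition antecedent (C : {fset literal T}) : {set L} :=
  [set y | compl (lit y) \in C].

Definition rules (x : L) : seq {set L} :=
  [seq antecedent (C `\ lit x) | C <- enum_fset F & lit x \in C].

Definition goals : seq {set L} := [seq antecedent C | C <- enum_fset F].

Lemma lit_inj : injective lit.
Proof. by case=> u b [w c] [/val_inj -> ->]. Qed.

Lemma lit_surj C x : C \in F -> x \in C -> exists y, lit y = x.
Proof. by move=> CF xC; exists ([` in_vars CF xC], x.2);
  exact/esym/surjective_pairing. Qed.

(** One round of unit propagation from the derived literals [D], in the negated form that matches a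
    gate of [layer]. *)
Definition propagate (G : {set edge}) (D : {set L}) : {set L} :=
  [set x | ~~ ((if init x is Some e then e \in G else true) &&
    all (fun Y : {set L} => [exists y in Y, y \notin D]) (rules x))].

(* The circuit computes the complement of what unit propagation has derived,
   since only that complement is monotone in [G]. *)
Lemma layerE t x G : layer init rules t x G = (x \notin iter t (propagate G) set0).
Proof.
elim: t x => [|t IHt] x /=; first by rewrite inE.
rewrite inE negbK; congr (_ && _); apply: eq_all => Y.
by apply: eq_existsb => y; rewrite IHt.
Qed.

Lemma propagate_mono G : {homo propagate G : D D' / D \subset D'}.
Proof.
move=> D D' /subsetP DD; apply/subsetP => x; rewrite !inE; apply: contra.
move=> /andP[-> /=]; apply: sub_all => Y /existsP[y /andP[yY yD]].
by apply/existsP; exists y; rewrite yY; apply: contra yD; apply: DD.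
Qed.

Hypotheses (F_clauses : is_clause_set F) (F_php : represents F (PHP p) (php_vars p)).

(** Soundness of unit propagation: some satisfying assignment [phi] of [F] extends the permutation.
    Literals false under [phi] are never derived, so no clause gets falsified. *)
Lemma output_perm t s : output init rules t goals (graph s).
Proof.
have [_ /(_ (perm_assignment s)) [_]] := F_php.
case/(_ (perm_assignment_sat s)) => phi [dphi /apply_pa_eq0 sat] phiV.
have phip e : phi.[? p e] = Some (e \in graph s).
  have := perm_assignmentE s e.1 e.2; rewrite -surjective_pairing -phiV inE.
  by rewrite fnd_restrict in_php_vars.
have covered t' (C : {fset literal T}) :
    (forall y, lit_val phi (lit y) = Some false -> layer init rules t' y (graph s)) ->
    forall x, x \in C -> lit_val phi x = Some true ->
    x.1 \in vars F -> [exists y in antecedent C, layer init rules t' y (graph s)].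
  move=> lay x xC x1 xF; apply/existsP; exists ([` xF], ~~ x.2).
  rewrite inE /lit /compl /= negbK -surjective_pairing xC; apply: lay.
  move: x1; rewrite /lit_val /lit /=; case: phi.[? _] => //= b.
  by case: (x.2) b => [] [].
have lay t' y : lit_val phi (lit y) = Some false -> layer init rules t' y (graph s).
  elim: t' y => // t' IHt y y0 /=; apply/andP; split.
    rewrite /init; case: pickP => // e /eqP ye.
    by move: y0; rewrite ye /lit_val /= phip; case: (_ \in _).
  apply/allP => _ /mapP[C + ->]; rewrite mem_filter => /andP[yC CF].
  have /hasP[x xC /eqP x1] := sat C CF.
  apply: (covered _ _ IHt x) => //; last exact: in_vars CF xC.
  by rewrite !inE xC andbT; apply/eqP => xy; rewrite xy y0 in x1.
apply/allP => _ /mapP[C CF ->]; have /hasP[x xC /eqP x1] := sat C CF.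
by apply: (covered _ _ (lay t) x) => //; apply: in_vars CF xC.
Qed.

Lemma php_vars_sub : php_vars p `<=` vars F.
Proof. by case: F_php. Qed.

Definition nonedges (G : {set edge}) : {fmap T -> bool} :=
  [fmap v : [fset v in php_vars p | [exists e, (e \notin G) && (v == p e)]] => false].

Lemma nonedges_dom G : domf (nonedges G) `<=` php_vars p.
Proof. by apply/fsubsetP => v; rewrite !inE => /andP[]. Qed.

Lemma nonedgesE G v b : (nonedges G).[? v] = Some b ->
  b = false /\ exists2 e, e \notin G & v = p e.
Proof.
case: fndP => // vG [<-]; rewrite ffunE; split=> //.
by move: vG; rewrite !inE => /andP[_ /existsP[e /andP[eG /eqP ->]]]; exists e.
Qed.

Lemma nonedges_false (G : {set edge}) e : e \notin G ->
  (nonedges G).[? p e] = Some false.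
Proof.
move=> eG; have vG : p e \in domf (nonedges G).
  by rewrite !inE in_php_vars; apply/existsP; exists e; rewrite eG eqxx.
by rewrite in_fnd ffunE.
Qed.

(** A satisfying assignment together with [nonedges G] restricts to a solution of [PHP p], and the
    variables it sets to true belong to edges of [G]. *)
Lemma sat_nonedges (G : {set edge}) : ~ unsat (apply_pa (nonedges G) F) ->
  exists s : {perm 'I_m}, graph s \subset G.
Proof.
move=> /existsNP[phi /contrapT/apply_pa_eq0 sat].
(* [nonedges G] takes precedence over [phi]; variables assigned by neither are set to false to make
   the assignment total. *)
pose phi' : {fmap T -> bool} := [fmap v : vars F =>
  if (nonedges G).[? val v] is Some b then b else odflt false phi.[? val v]].
have phi'E v : v \in vars F -> phi'.[? v] =
    Some (if (nonedges G).[? v] is Some b then b else odflt false phi.[? v]).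
  by move=> vF; rewrite (in_fnd (f := phi') vF) ffunE.
have sat' : total_sat F phi'.
  split=> //; apply/apply_pa_eq0 => C CF.
  have [/hasP[x xC]|nC] := boolP (satisfies_clause (nonedges G) C).
    rewrite /lit_val => x1; apply/hasP; exists x => //.
    rewrite /lit_val phi'E ?(in_vars CF xC) //.
    by case: (nonedges G).[? _] x1.
  have restr : [fset x in C | lit_val (nonedges G) x != Some false]
      \in apply_pa (nonedges G) F.
    by apply/imfsetP; exists C; rewrite //= inE /= CF nC.
  have /hasP[x] := sat _ restr; rewrite !inE => /andP[xC xn] x1.
  apply/hasP; exists x => //; rewrite /lit_val phi'E ?(in_vars CF xC) //.
  have : lit_val (nonedges G) x != Some true.
    by apply: contra nC => x2; apply/hasP; exists x.
  move: xn x1; rewrite /lit_val; case: (nonedges G).[? x.1] => [b|].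
    by case: (x.2) b => [] [].
  by case: phi.[? x.1].
have [_ /(_ phi'.[& php_vars p]) [+ _]] := F_php.
case=> [|_ /sat_perm[s sP]]; first by exists phi'.
exists s; apply/subsetP => -[i j]; rewrite inE /= => /eqP <-.
apply/negPn/negP => nG; move: (sP i).
rewrite fnd_restrict in_php_vars phi'E ?nonedges_false //.
by rewrite (fsubsetP php_vars_sub) ?in_php_vars.
Qed.

Hypothesis F_hard : hdV (php_vars p) F <= 1.

(** Without a perfect matching in [G] there is a refutation of Horton-Strahler number at most 1, and
    the literals closed under unit propagation then falsify a clause, against the output. *)
Lemma output_sound (G : {set edge}) : output init rules #|{: L}| goals G ->
  exists s : {perm 'I_m}, graph s \subset G.
Proof.
move=> out; apply: sat_nonedges => un.
have [t [tF t0] ht] := hd_attained (apply_pa_clause_set (phi := nonedges G)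
  F_clauses) un.
have ht1 : hts t <= 1.
  by rewrite ht (leq_trans _ F_hard) // hd_le_hdV // nonedges_dom.
(* [fixset] iterates from the empty set as often as there are elements in the type, which is the
   depth of the circuit here. *)
pose D := fixset (propagate G).
have DE : propagate G D = D := fixsetK (@propagate_mono G).
pose der x := [exists y, (lit y == x) && (y \in D)].
have derE y : der (lit y) = (y \in D).
  apply/existsP/idP => [[z /andP[/eqP/lit_inj ->]]|yD] //.
  by exists y; rewrite eqxx.
have [|||C CF Cf] := unit_propagation_refutes (der := der) _ _ tF ht1.
- move=> v b /nonedgesE[-> [e eG ve]].
  have vF : v \in vars F by rewrite ve (fsubsetP php_vars_sub) ?in_php_vars.
  rewrite -[(v, false)]/(lit ([` vF], false)) derE -DE inE.
  rewrite /init; case: pickP => [e' /eqP[]|/(_ e)/eqP[]]; last by rewrite /lit /= ve.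
  by move=> ve'; rewrite -(p_inj (etrans (esym ve) ve')) (negbTE eG).
- move=> C x CF xC Cx; have [y yx] := lit_surj CF xC; rewrite -yx derE -DE inE.
  apply/negP => /andP[_ /allP all_rules].
  have /existsP[z /andP[]] : [exists z in antecedent (C `\ x), z \notin D].
    by apply: all_rules; rewrite -yx; apply/mapP; exists C; rewrite // mem_filter yx xC.
  by rewrite !inE => /andP[zx /Cx/(_ zx)]; rewrite complK derE => ->.
- by move=> y; rewrite t0 in_fset0.
have /existsP[y /andP[]] : [exists y in antecedent C, layer init rules #|{: L}| y G].
  by apply: (allP out); apply/mapP; exists C.
by rewrite inE layerE => /Cf; rewrite complK derE /D /fixset => ->.
Qed.
End Pigeonhole.

(** * Circuit size and choice of parameters *)

Section Sizes.
Variables (T : choiceType) (F : {fset {fset literal T}}).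

Lemma card_vars_le : #|` vars F| <= ell F.
Proof.
pose s := [seq x.1 | x <- flatten [seq enum_fset C | C <- enum_fset F]].
have ss : size s = ell F.
  by rewrite size_map size_flatten /shape -map_comp sumnE big_map.
rewrite -ss; apply: uniq_leq_size (fset_uniq _) _ => v.
case/imfset2P=> C /= CF [x xC ->]; apply/map_f/flattenP.
by exists (enum_fset C) => //; apply: map_f.
Qed.

(** Only the empty clause contributes nothing to [ell F]. *)
Lemma card_clauses_le : #|` F| <= (ell F).+1.
Proof.
rewrite -(count_predC (pred1 fset0)) -add1n leq_add //.
  by rewrite count_uniq_mem ?fset_uniq // leq_b1.
rewrite /ell; elim: (enum_fset F) => [|C s IHs]; first by rewrite big_nil.
rewrite big_cons /= leq_add // -cardfs_gt0.
by case: (#|` C|).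
Qed.
End Sizes.

Lemma circuit_size_bound (T : choiceType) m (p : 'I_m * 'I_m -> T)
    (F : {fset {fset literal T}}) l r :
  injective p -> is_clause_set F -> represents F (PHP p) (php_vars p) ->
  hdV (php_vars p) F <= 1 -> 0 < l < m ->
  m ^_ l <= 8 * (ell F).+1 ^ 3 * (branching l r ^ (2 * l)) ^ 2 \/
  2 ^ r <= 8 * (ell F).+1 ^ 3 * ((m * m).+1 ^ l * 2 ^ (2 * l).+1).
Proof.
move=> p_inj clF rep hard lm.
apply: (@matching_circuit_bound m l r _ (@init T m p F) (@rules T F)
  #|{: vars F * bool}| (@goals T F) #|` F|.+1) => //.
- by move=> x; rewrite ltnS size_map size_filter count_size.
(* Rounds and gates per round both number twice the variables of [F]; a gate costs one more than the
   number of clauses, and each clause is a goal. *)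
- rewrite size_map card_prod card_bool -!cardfE.
  have := card_vars_le F; have := card_clauses_le F.
  set e := ell F; set v := #|` vars F|; set f := #|` F| => fe ve.
  have : v * 2 * (v * 2 * f.+1) + f <= e * 2 * (e * 2 * e.+2) + e.+1.
    by rewrite leq_add // !leq_mul.
  move=> /leq_trans; apply; rewrite !expnS expn0; nia.
- by move=> s; apply: output_perm.
- move=> h; apply: contraL => /(output_sound p_inj clF rep hard) [s].
  exact: even_colouring.
Qed.

Lemma quadratic_lt_exp l : 9 <= l -> 2 * l * (2 * l).+1 < 2 ^ l.
Proof.
elim: l => // l IHl; rewrite leq_eqVlt => /orP[/eqP <- //|].
by rewrite ltnS => l9; have := IHl l9; rewrite expnS; nia.
Qed.

(** The left side is (3 l^2 + 3) + 50 (l + 1) l + (2 l + 1), the exponent in the second alternative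
    of [ell_lower]. *)
Lemma quadratic_lt_exp4 l : 9 <= l -> 53 * l ^ 2 + 52 * l + 4 < 2 ^ (2 * l).
Proof.
move=> l9; have := quadratic_lt_exp l9; rewrite mul2n -addnn expnD.
by move: (2 ^ l) => x; rewrite expnS expn1; nia.
Qed.

Lemma ffact_lower m l b : l <= b -> m >= 2 * b -> b ^ l <= m ^_ l.
Proof.
move=> lb bm; rewrite ffact_prod -[X in b ^ X]card_ord -prod_nat_const.
by apply: leq_prod => i _; have := ltn_ord i; lia.
Qed.

(** Take [r = 2 ^ (2 * l)]. If [ell F] were smaller, both alternatives of [circuit_size_bound] would
    fail: the first compares the exponents 23 l^2 + 3 and 25 l^2 - l, the second a quadratic with
    [r]. *)
Lemma ell_lower (T : choiceType) m (p : 'I_m * 'I_m -> T)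
    (F : {fset {fset literal T}}) l :
  injective p -> is_clause_set F -> represents F (PHP p) (php_vars p) ->
  hdV (php_vars p) F <= 1 ->
  9 <= l -> 2 ^ (25 * l) <= m < 2 ^ (25 * l.+1) -> 2 ^ (l ^ 2) <= ell F.
Proof.
move=> p_inj clF rep hard l9 /andP[ml mu]; rewrite leqNgt; apply/negP => eF.
have e3 : 8 * (ell F).+1 ^ 3 <= 2 ^ (3 * l ^ 2 + 3).
  rewrite expnD [3 * _]mulnC expnM mulnC leq_mul2r /=.
  by rewrite leq_exp2r.
have l25 : l < 2 ^ (25 * l).-1.
  by apply: ltn_trans (ltn_expl (25 * l).-1 (ltnSn 1)); lia.
have b25 : 2 * 2 ^ (25 * l).-1 = 2 ^ (25 * l) by rewrite -expnS prednK //; lia.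
have lm : 0 < l < m by apply/andP; split; lia.
have br : branching l (2 ^ (2 * l)) <= 2 ^ (5 * l).
  rewrite /branching /petal_count -expnD -mulnA [2 ^ _ * _]mulnC mulnA.
  have -> : 5 * l = l + (2 * l + 2 * l) by lia.
  rewrite [in leqRHS]expnD ltn_mul2r ?expn_gt0 /=.
  exact: quadratic_lt_exp.
have [] := circuit_size_bound (2 ^ (2 * l)) p_inj clF rep hard lm; apply/negP;
  rewrite -ltnNge.
  (* Every factor of the falling factorial is at least half of [2 ^ (25 * l)]. *)
  apply: (@leq_trans ((2 ^ (25 * l).-1) ^ l)); last first.
    by apply: ffact_lower; [exact: ltnW|rewrite b25].
  apply: (@leq_ltn_trans (2 ^ (3 * l ^ 2 + 3) * ((2 ^ (5 * l)) ^ (2 * l)) ^ 2)).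
    by apply: leq_mul e3 _; rewrite leq_exp2r // leq_exp2r //; lia.
  rewrite -!expnM -expnD ltn_exp2l //.
  by rewrite !expnS expn0; nia.
apply: (@leq_ltn_trans (2 ^ (3 * l ^ 2 + 3) *
    ((2 ^ (2 * (25 * l.+1))) ^ l * 2 ^ (2 * l).+1))).
  rewrite leq_mul // leq_mul // leq_exp2r; last by lia.
  by rewrite mul2n -addnn expnD ltn_mul.
rewrite -expnM -!expnD ltn_exp2l //.
apply: leq_ltn_trans (quadratic_lt_exp4 l9).
by rewrite !expnS expn0; nia.
Qed.

(** * The lower bound *)

Import Order.TTheory GRing.Theory Num.Theory.
Local Open Scope ring_scope.

(** Used with [a] = l, [t] = ln 2 and [x] = ln m to compare the logarithms of the two bounds. It
    holds since (a + 1)^2 <= 4 a^2 and t^2 <= t, and 2500 = 4 * 25^2. *)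
Lemma exponent_bound (R : realFieldType) (a t x : R) :
  9 <= a -> 0 <= t -> t <= 1 -> 0 <= x -> x <= 25 * (a + 1) * t ->
  2500%:R^-1 * x * x <= a ^+ 2 * t.
Proof.
move=> a9 t0 t1 x0 xat.
have xx : x * x <= (25 * (a + 1) * t) * (25 * (a + 1) * t) by rewrite ler_pM.
have tt : t * t <= t by rewrite -[leRHS]mulr1 ler_wpM2l.
have aa : (a + 1) * (a + 1) <= (2 * a) * (2 * a) by apply: ler_pM; lra.
have step : (a + 1) * (a + 1) * (t * t) <= (2 * a) * (2 * a) * t.
  by apply: ler_pM => //; apply: mulr_ge0 => //; lra.
rewrite -mulrA ler_pdivrMl ?ltr0n //; apply: le_trans xx _.
have -> : 25 * (a + 1) * t * (25 * (a + 1) * t) =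
    625 * ((a + 1) * (a + 1) * (t * t)) by ring.
have -> : 2500 * (a ^+ 2 * t) = 625 * ((2 * a) * (2 * a) * t) by ring.
by rewrite ler_wpM2l.
Qed.

Theorem theorem8p9 (R : realType) :
  exists2 c : R, 0 < c &
  exists m0 : nat, forall m : nat, (m0 <= m)%N ->
  forall (T : choiceType) (p : 'I_m * 'I_m -> T), injective p ->
  forall F : {fset {fset literal T}},
    is_clause_set F ->
    represents F (PHP p) (php_vars p) ->
    (hdV (php_vars p) F <= 1)%N ->
    (m%:R `^ (c * ln m%:R) <= (ell F)%:R :> R).
Proof.
exists (2500%:R^-1); first by rewrite invr_gt0 ltr0n.
(* 225 = 25 * 9 ensures [9 <= l] for the [l] chosen below. *)
exists (2 ^ 225)%N => m m_large T p p_inj F clF rep hard.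
have m_gt0 : (0 < m)%N by apply: leq_trans m_large; rewrite expn_gt0.
pose l := (trunc_log 2 m %/ 25)%N.
have l9 : (9 <= l)%N by rewrite leq_divRL // trunc_log_max.
have ml : (2 ^ (25 * l) <= m)%N.
  apply: (@leq_trans (2 ^ trunc_log 2 m)); last exact: trunc_logP.
  by rewrite leq_exp2l // mulnC leq_divM.
have mu : (m < 2 ^ (25 * l.+1))%N.
  apply: leq_trans (trunc_log_ltn m (ltnSn 1)) _; rewrite leq_exp2l //.
  by rewrite mulnC ltn_ceil.
have := ell_lower p_inj clF rep hard l9.
rewrite ml mu => /(_ isT) ellF.
apply: (@le_trans _ _ (2 ^ (l ^ 2))%N%:R); last by rewrite ler_nat.
have mR : 0 < m%:R :> R by rewrite ltr0n.
rewrite natrX /powR gt_eqF // -[2%:R]lnK ?posrE ?ltr0n //.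
rewrite -expRM_natl ler_expR.
have ln2 : 0 <= ln 2%:R :> R by rewrite ln_ge0 // ler1n.
have ln2' : ln 2%:R <= 1 :> R.
  by apply: (@le_ln1Dx _ 1); rewrite (lt_trans _ ltr01) // oppr_lt0.
have lnm0 : 0 <= ln m%:R :> R by rewrite ln_ge0 // ler1n.
have lnm : ln m%:R <= 25 * (l%:R + 1) * ln 2%:R :> R.
  have : m%:R <= 2%:R ^+ (25 * l.+1) :> R by rewrite -natrX ler_nat ltnW.
  rewrite -ler_ln ?posrE ?exprn_gt0 ?ltr0n // lnXn ?ltr0n // => /le_trans; apply.
  by rewrite -[leLHS]mulr_natl natrM -[l.+1%:R]natr1.
by rewrite natrX exponent_bound // ler_nat.
Qed.
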